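(* Let $M$ be a finitely generated $A_n$-module with system of generators $\{f_1,\dots,f_m\}$, and let $E$ be a free $A_n$-module with basis $e_1,\dots,e_m$. Let $\pi:E\to M$ be the natural $A_n$-epimorphism of $E$ onto $M$ defined by $\pi(e_i)=f_i$ for all $i=1,\dots,m$. Furthermore, let $N=\mathrm{Ker}(\pi)$, and let $G=\{g_1,\dots,g_s\}$ be a Gröbner basis of $N$. Finally, treat $M$ as a filtered $A_n$-module with the filtration $M_r=\sum_{i=1}^mB_rf_i$ $(r\in\mathbb N)$, where $\{B_r\}_{r\in\mathbb N}$ is the Bernstein filtration with $B_r=\{D\in A_n:\deg(D)\le r\}$, and let $U_r$ denote the set of all $w\in\Theta e$ such that $\deg(w)\le r$ and $w$ is not a multiple of any $LM(g_j)$ $(1\le j\le s)$. Then $\pi(U_r)$ is a basis of the $K$-vector space $M_r$.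
   Context: Let $K$ be a field and $n\ge 1$. $A_n=A_n(K)$ is the $n$th Weyl algebra: the $K$-subalgebra of $\mathrm{End}_K(K[x_1,\dots,x_n])$ generated by the multiplication operators $x_1,\dots,x_n$ and the partial derivatives $\partial_1,\dots,\partial_n$. Modules are unitary left modules. $\mathbb N$ includes $0$. For $\alpha,\beta\in\mathbb N^n$, $x^\alpha\partial^\beta=x_1^{\alpha_1}\cdots x_n^{\alpha_n}\partial_1^{\beta_1}\cdots\partial_n^{\beta_n}$ is called a monomial, of degree $|\alpha|+|\beta|=\sum_i\alpha_i+\sum_i\beta_i$. $\Theta$ is the set of all monomials; it is taken as known that each element of $A_n$ can be written in a unique way as a finite $K$-linear combination of monomials. $B_r$ is the $K$-vector space generated by the monomials of degree $\le r$. Order on $\Theta$: $x^\alpha\partial^\beta<x^\gamma\partial^\delta$ iff $(|\alpha|+|\beta|,\alpha_1,\dots,\alpha_n,\beta_1,\dots,\beta_n)$ is smaller than $(|\gamma|+|\delta|,\gamma_1,\dots,\gamma_n,\delta_1,\dots,\delta_n)$ in the lexicographic order on $\mathbb N^{2n+1}$. Divisibility: $x^\alpha\partial^\beta$ divides $x^\gamma\partial^\delta$ iff $\alpha_i\le\gamma_i$ and $\beta_i\le\delta_i$ for all $i$. For $E$ free on $e_1,\dots,e_m$, the monomials of $E$ are the elements of $\Theta e=\{\theta e_i:\theta\in\Theta,\ 1\le i\le m\}$, regarded as a $K$-basis of $E$, with $\deg(\theta e_i)=\deg\theta$, ordered by $\theta e_i<\theta'e_j$ iff $\theta<\theta'$,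 or $\theta=\theta'$ and $i<j$. $\theta'e_i$ is a multiple of $\theta e_j$ (and $\theta e_j$ divides $\theta' e_i$) iff $i=j$ and $\theta$ divides $\theta'$. For $0\ne f\in E$, $LM(f)$ is the greatest monomial appearing in $f$ with nonzero coefficient. Gröbner basis: a finite set $G=\{g_1,\dots,g_s\}$ of nonzero elements contained in a submodule $N\subseteq E$ is a Gröbner basis for $N$ if for any nonzero $f\in N$ there exists $g_i\in G$ such that $LM(g_i)$ divides $LM(f)$.
   Formalization: K is assumed to have characteristic 0: for A_n defined as operators on K[x_1,…,x_n], in characteristic p one has ∂_i^p = 0, so monomials are not linearly independent and LM is not well defined. *)

(* Defs.v *)
From HB Require Import structures.
From mathcomp Require Import all_boot all_order all_algebra.
From mathcomp Require Import boolp classical_sets.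
From mathcomp.multinomials Require Import mpoly.

Set Implicit Arguments.
Unset Strict Implicit.
Unset Printing Implicit Defensive.

Import Order.TTheory GRing.Theory.
Local Open Scope ring_scope.
Local Open Scope classical_set_scope.

Definition polyEnd (K : fieldType) (n : nat) : Type :=
  {linear {mpoly K[n]} -> {mpoly K[n]}}.

Section PolyEndAlgebra.
Variables (K : fieldType) (n : nat).
Local Notation P := {mpoly K[n]}.
Local Notation E := (polyEnd K n).
Implicit Types (a b : K) (f g h : E).

Definition polyEnd_fun (f : E) : P -> P := f.

Lemma polyEnd_eq f g : polyEnd_fun f =1 polyEnd_fun g -> f = g.
Proof.
rewrite /polyEnd_fun; case: f g => [f [[fN] [fL]]] [g [[gN] [gL]]] /= /funext fg.
subst g; congr (GRing.Linear.Pack (GRing.Linear.Class _ _)).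
- by congr Algebra.isNmodMorphism.Axioms_; apply: Prop_irrelevance.
- by congr GRing.isScalable.Axioms_; apply: Prop_irrelevance.
Qed.

Fact polyEnd_opp_linear f : linear (fun p : P => - f p).
Proof. by move=> a u v; rewrite linearP opprD scalerN. Qed.
Fact polyEnd_add_linear f g : linear (fun p : P => f p + g p).
Proof. by move=> a u v; rewrite !linearP scalerDr addrACA. Qed.
Fact polyEnd_zero_linear : linear (fun _ : P => 0 : P).
Proof. by move=> a u v; rewrite scaler0 addr0. Qed.
Fact polyEnd_one_linear : linear (fun p : P => p).
Proof. by []. Qed.
Fact polyEnd_mul_linear f g : linear (fun p : P => f (g p)).
Proof. by move=> a u v; rewrite !linearP. Qed.
Fact polyEnd_scale_linear a f : linear (fun p : P => a *: f p).
Proof. by move=> b u v; rewrite linearP scalerDr !scalerA mulrC. Qed.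

Definition mk_polyEnd (f : P -> P) (fL : linear f) : E :=
  HB.pack_for E f (GRing.isLinear.Build K P P *:%R f fL).

Definition polyEnd_opp f := mk_polyEnd (polyEnd_opp_linear f).
Definition polyEnd_add f g := mk_polyEnd (polyEnd_add_linear f g).
Definition polyEnd_zero := mk_polyEnd polyEnd_zero_linear.
Definition polyEnd_one := mk_polyEnd polyEnd_one_linear.
Definition polyEnd_mul f g := mk_polyEnd (polyEnd_mul_linear f g).
Definition polyEnd_scale a f := mk_polyEnd (polyEnd_scale_linear a f).

HB.instance Definition _ := gen_eqMixin E.
HB.instance Definition _ := gen_choiceMixin E.

Fact polyEnd_addA : associative polyEnd_add.
Proof. by move=> f g h; apply: polyEnd_eq => p; apply: addrA. Qed.
Fact polyEnd_addC : commutative polyEnd_add.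
Proof. by move=> f g; apply: polyEnd_eq => p; apply: addrC. Qed.
Fact polyEnd_add0 : left_id polyEnd_zero polyEnd_add.
Proof. by move=> f; apply: polyEnd_eq => p; apply: add0r. Qed.
Fact polyEnd_addN : left_inverse polyEnd_zero polyEnd_opp polyEnd_add.
Proof. by move=> f; apply: polyEnd_eq => p; apply: addNr. Qed.

HB.instance Definition _ := GRing.isZmodule.Build E
  polyEnd_addA polyEnd_addC polyEnd_add0 polyEnd_addN.

(* The product of End_K(K[x_1, ..., x_n]) is composition. *)
Fact polyEnd_mulA : associative polyEnd_mul.
Proof. by move=> f g h; apply: polyEnd_eq. Qed.
Fact polyEnd_mul1 : left_id polyEnd_one polyEnd_mul.
Proof. by move=> f; apply: polyEnd_eq. Qed.
Fact polyEnd_mulr1 : right_id polyEnd_one polyEnd_mul.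
Proof. by move=> f; apply: polyEnd_eq. Qed.
Fact polyEnd_mulDl : left_distributive polyEnd_mul +%R.
Proof. by move=> f g h; apply: polyEnd_eq. Qed.
Fact polyEnd_mulDr : right_distributive polyEnd_mul +%R.
Proof. by move=> f g h; apply: polyEnd_eq => p; apply: raddfD. Qed.
Fact polyEnd_oner_neq0 : polyEnd_one != 0 :> E.
Proof.
apply/eqP => /(congr1 (fun f : E => f 1)) /= /eqP.
by rewrite oner_eq0.
Qed.

HB.instance Definition _ := GRing.Zmodule_isNzRing.Build E
  polyEnd_mulA polyEnd_mul1 polyEnd_mulr1 polyEnd_mulDl polyEnd_mulDr
  polyEnd_oner_neq0.

Fact polyEnd_scaleA a b f :
  polyEnd_scale a (polyEnd_scale b f) = polyEnd_scale (a * b) f.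
Proof. by apply: polyEnd_eq => p; apply: scalerA. Qed.
Fact polyEnd_scale1 : left_id 1 polyEnd_scale.
Proof. by move=> f; apply: polyEnd_eq => p; apply: scale1r. Qed.
Fact polyEnd_scaleDr : right_distributive polyEnd_scale +%R.
Proof. by move=> a f g; apply: polyEnd_eq => p; apply: scalerDr. Qed.
Fact polyEnd_scaleDl f : {morph polyEnd_scale^~ f : a b / a + b}.
Proof. by move=> a b; apply: polyEnd_eq => p; apply: scalerDl. Qed.

HB.instance Definition _ := GRing.Zmodule_isLmodule.Build K E
  polyEnd_scaleA polyEnd_scale1 polyEnd_scaleDr polyEnd_scaleDl.

Fact polyEnd_scaleAl a f g : a *: (f * g) = (a *: f) * g.
Proof. exact: polyEnd_eq. Qed.
HB.instance Definition _ := GRing.Lmodule_isLalgebra.Build K E polyEnd_scaleAl.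

Fact polyEnd_scaleAr a f g : a *: (f * g) = f * (a *: g).
Proof.
by apply: polyEnd_eq => p; symmetry; apply: (linearZ_LR (f : {linear P -> P})).
Qed.
HB.instance Definition _ := GRing.Lalgebra_isAlgebra.Build K E polyEnd_scaleAr.

Fact mulX_linear (i : 'I_n) : linear (fun p : P => 'X_i * p).
Proof. by move=> a u v; rewrite mulrDr scalerAr. Qed.

Definition opX (i : 'I_n) : E := mk_polyEnd (mulX_linear i).
Definition opD (i : 'I_n) : E := mderiv i.

End PolyEndAlgebra.

Section Weyl.
Variables (K : fieldType) (n : nat).
Local Notation E := (polyEnd K n).

(* The generated subalgebra is the intersection of all subalgebras containing
   the generators; asbool (classical logic) makes it a boolean predicate. *)
Definition weyl_mem : {pred E} := fun D => `[< forall S : {pred E},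
  GRing.subalg_closed S ->
  (forall i, opX K i \in S) -> (forall i, opD K i \in S) -> D \in S >].

Fact weyl_subalg_closed : GRing.subalg_closed weyl_mem.
Proof.
split=> [|a u v|u v].
- by apply/asboolP => S [].
- move=> /asboolP uS /asboolP vS; apply/asboolP => S Salg XS DS.
  by have [_ SL _] := Salg; apply: SL; [apply: uS|apply: vS].
- move=> /asboolP uS /asboolP vS; apply/asboolP => S Salg XS DS.
  by have [_ _ SM] := Salg; apply: SM; [apply: uS|apply: vS].
Qed.

HB.instance Definition _ :=
  GRing.isSubalgClosed.Build K E weyl_mem weyl_subalg_closed.

Record weyl : Type := Weyl { weyl_val :> E ; _ : weyl_val \in weyl_mem }.

HB.instance Definition _ := [isSub for weyl_val].
HB.instance Definition _ := [Choice of weyl by <:].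
HB.instance Definition _ := [SubChoice_isSubAlgebra of weyl by <:].

Fact opX_weyl i : opX K i \in weyl_mem.
Proof. by apply/asboolP => S _ XS _; apply: XS. Qed.
Fact opD_weyl i : opD K i \in weyl_mem.
Proof. by apply/asboolP => S _ _ DS; apply: DS. Qed.

Definition wX (i : 'I_n) : weyl := Weyl (opX_weyl i).
Definition wD (i : 'I_n) : weyl := Weyl (opD_weyl i).

End Weyl.

(* The pair (a, b) encodes the monomial x^a d^b. *)
Definition Theta (n : nat) : Type := ('X_{1..n} * 'X_{1..n})%type.

HB.instance Definition _ (n : nat) := Choice.on (Theta n).

Definition tdeg (n : nat) (t : Theta n) : nat := (mdeg t.1 + mdeg t.2)%N.

Definition wmon (K : fieldType) (n : nat) (t : Theta n) : weyl K n :=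
  (\prod_(i < n) wX K i ^+ t.1 i) * (\prod_(i < n) wD K i ^+ t.2 i).

Definition tkey (n : nat) (t : Theta n) : seqlexi nat :=
  tdeg t :: (t.1 : seq nat) ++ (t.2 : seq nat).

Definition tlt (n : nat) (t u : Theta n) : bool := (tkey t < tkey u)%O.

(* (_ <= _)%MM is the componentwise order, and not an order of type %O. *)
Definition tdvd (n : nat) (t u : Theta n) : bool :=
  (t.1 <= u.1)%MM && (t.2 <= u.2)%MM.

Definition bernstein (K : fieldType) (n r : nat) : set (weyl K n) :=
  [set D | exists (s : seq (Theta n)) (c : Theta n -> K),
     {in s, forall t, (tdeg t <= r)%N} /\
     D = \sum_(t <- s) c t *: wmon K t].

Section Modules.
Variables (R : nzRingType) (V : lmodType R) (m : nat) (e : 'I_m -> V).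

Definition generators : Prop :=
  forall v : V, exists a : 'I_m -> R, v = \sum_i a i *: e i.

Definition module_basis : Prop :=
  forall v : V, exists! a : {ffun 'I_m -> R}, v = \sum_i a i *: e i.

End Modules.

(* A module V over a K-algebra A is a K-vector space through c |-> c%:A. *)
Section VectorSpace.
Variables (K : fieldType) (A : algType K) (V : lmodType A).
Variables (I : choiceType) (S : set I) (b : I -> V).

Definition kspan : set V :=
  [set v | exists (s : seq I) (c : I -> K),
     {in s, forall i, S i} /\ v = \sum_(i <- s) (c i)%:A *: b i].

Definition kfree : Prop :=
  forall (s : seq I) (c : I -> K), uniq s -> {in s, forall i, S i} ->
    \sum_(i <- s) (c i)%:A *: b i = 0 -> {in s, forall i, c i = 0}.

(* The family (b i) indexed by S is a K-basis of W; in particular, b is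
   injective on S. *)
Definition kbasis (W : set V) : Prop := kfree /\ kspan = W.

End VectorSpace.

Section Groebner.
Variables (K : fieldType) (n m : nat).

(* The pair (t, i) encodes the monomial t e_i. *)
Definition Thetae : Type := (Theta n * 'I_m)%type.

HB.instance Definition _ := Choice.on Thetae.

Implicit Types u w : Thetae.

Definition tedeg w : nat := tdeg w.1.

Definition telt w u : bool :=
  tlt w.1 u.1 || (w.1 == u.1) && (w.2 < u.2)%N.

Definition tedvd u w : bool := (u.2 == w.2) && tdvd u.1 w.1.

Variables (E : lmodType (weyl K n)) (e : 'I_m -> E).

Definition temon w : E := wmon K w.1 *: e w.2.

(* w = LM(f): the monomials in s are those appearing in f with nonzero
   coefficient. *)
Definition is_LM (f : E) w : Prop :=
  exists (s : seq Thetae) (c : Thetae -> K),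
    [/\ uniq s, {in s, forall u, c u != 0},
        f = \sum_(u <- s) (c u)%:A *: temon u,
        w \in s & {in s, forall u, u != w -> telt u w}].

Definition groebner_basis (N : set E) (s : nat) (g : 'I_s -> E) : Prop :=
  [/\ forall j, g j != 0,
      forall j, N (g j)
    & forall f, N f -> f != 0 ->
        exists (j : 'I_s) u w, [/\ is_LM (g j) u, is_LM f w & tedvd u w]].

Definition irreducible_monomials (s : nat) (g : 'I_s -> E) (r : nat) :
    set Thetae :=
  [set w | (tedeg w <= r)%N /\
     forall (j : 'I_s) u, is_LM (g j) u -> ~~ tedvd u w].

End Groebner.

Definition filtration (K : fieldType) (n m : nat) (M : lmodType (weyl K n))
    (f : 'I_m -> M) (r : nat) : set M :=
  [set v | exists D : 'I_m -> weyl K n,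
     (forall i, bernstein r (D i)) /\ v = \sum_i D i *: f i].

(* Main.v *)
(* Multiplying by a monomial theta is, up to terms of lower degree, the shift
   of exponents by theta, and the order on Theta e is compatible with shifts.
   Spanning: if w is a multiple theta LM(g_j), then theta g_j is a nonzero
   multiple of w plus smaller monomials and is killed by pi, so pi(w) is a
   combination of the pi(w') with w' < w, and one concludes by well-founded
   induction. Independence: a linear relation between the pi(w), w in U_r, is an
   element of N supported on U_r, and its leading monomial would be divisible by
   some LM(g_j) unless it is 0; then all coefficients vanish because Theta is
   linearly independent, as one sees by applying a differential operator
   sum c(a, b) x^a d^b to x^b with |b| minimal among the exponents with
   c(a, b) <> 0, the factor b! being nonzero in characteristic 0. *)

Require Import Defs.
From mathcomp Require Import all_boot all_order all_algebra.
From mathcomp Require Import boolp classical_sets.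
From mathcomp.multinomials Require Import mpoly.

Set Implicit Arguments.
Unset Strict Implicit.
Unset Printing Implicit Defensive.

Import GRing.Theory.
Local Open Scope ring_scope.
Local Open Scope classical_set_scope.

Lemma submm n (a : 'X_{1..n}) : (a - a = 0)%MM.
Proof. by rewrite -{1}[a]add0m addmK. Qed.

(** Serves to put two expansions over different lists onto one common duplicate-free list,
    multiplicities being absorbed into the coefficients. *)
Lemma sum_count_mem (I : eqType) (V : zmodType) (F : I -> V) (r s : seq I) :
    uniq r -> {subset s <= r} ->
  \sum_(i <- s) F i = \sum_(i <- r) F i *+ count_mem i s.
Proof.
move=> r_uniq; elim: s => [|j s IH] sr; first by rewrite big_nil big1.
rewrite big_cons IH => [|i si]; last by rewrite sr ?inE ?si ?orbT.
under [RHS]eq_bigr => i _ do rewrite /= mulrnDr.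
rewrite big_split /= [X in _ = X + _](bigD1_seq j) ?sr ?mem_head //= eqxx.
rewrite [X in _ = _ + X + _]big1 ?addr0 // => i ij.
by rewrite eq_sym (negPf ij).
Qed.

(** * K-linear spans in modules over a K-algebra *)

Section KSpan.
Variables (K : fieldType) (A : algType K).

Section Closure.
Variables (V : lmodType A) (I : choiceType) (S : set I) (b : I -> V).

Lemma kspan0 : kspan S b 0.
Proof. by exists [::], (fun=> 0); split=> //; rewrite big_nil. Qed.

Lemma kspan_gen i : S i -> kspan S b (b i).
Proof.
move=> Si; exists [:: i], (fun=> 1); split=> [j|].
  by rewrite inE => /eqP->.
by rewrite big_seq1 !scale1r.
Qed.

Lemma kspanZ a v : kspan S b v -> kspan S b (a%:A *: v).
Proof.
case=> s [c [sS ->]]; exists s, (fun i => a * c i); split=> //.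
rewrite scaler_sumr; apply: eq_bigr => i _.
by rewrite scalerA mulr_algl scalerA.
Qed.

Lemma kspanD v w : kspan S b v -> kspan S b w -> kspan S b (v + w).
Proof.
case=> [s [c [sS ->]]] [s' [c' [s'S ->]]]; pose r := undup (s ++ s').
exists r, (fun i => c i *+ count_mem i s + c' i *+ count_mem i s').
split=> [i|]; first by rewrite mem_undup mem_cat => /orP[/sS|/s'S].
rewrite (@sum_count_mem _ _ _ r) ?undup_uniq //; last first.
  by move=> i si; rewrite mem_undup mem_cat si.
rewrite [X in _ + X](@sum_count_mem _ _ _ r) ?undup_uniq //; last first.
  by move=> i si; rewrite mem_undup mem_cat si orbT.
rewrite -big_split; apply: eq_bigr => i _ /=.
by rewrite !scalerDl !scalerMnl.
Qed.

Lemma kspanN v : kspan S b v -> kspan S b (- v).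
Proof. by move=> /(kspanZ (-1)); rewrite scaleNr scale1r scaleN1r. Qed.

Lemma kspan_sum J (s : seq J) (Q : pred J) (F : J -> V) :
  (forall j, Q j -> kspan S b (F j)) -> kspan S b (\sum_(j <- s | Q j) F j).
Proof. by move=> FS; apply: big_ind => //; [exact: kspan0|exact: kspanD]. Qed.

End Closure.

(** Only K-linearity is asked of [h], so that left multiplication by an operator and
    [D |-> D *: e i] are covered as well as [pi]. *)
Lemma kspan_morph (V W : lmodType A) (I J : choiceType) (S : set I) (T : set J)
    (b : I -> V) (b' : J -> W) (h : V -> W) :
    (forall a v w, h (a%:A *: v + w) = a%:A *: h v + h w) ->
    (forall i, S i -> kspan T b' (h (b i))) ->
  forall v, kspan S b v -> kspan T b' (h v).
Proof.
move=> hL hS _ [s [c [sS ->]]]; elim: s sS => [|i s IH] sS.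
  rewrite big_nil; suff -> : h 0 = 0 by exact: kspan0.
  (* The case [a = -1], [v = w = 0] reads [h 0 = - h 0 + h 0]. *)
  by have := hL (-1) 0 0; rewrite scaler0 addr0 scaleNr !scale1r scaleN1r addNr.
rewrite big_cons hL; apply: kspanD; first by apply/kspanZ/hS/sS/mem_head.
by apply: IH => j js; apply: sS; rewrite inE js orbT.
Qed.

Lemma kspan_sub (V : lmodType A) (I J : choiceType) (S : set I) (T : set J)
    (b : I -> V) (b' : J -> V) :
    (forall i, S i -> kspan T b' (b i)) -> kspan S b `<=` kspan T b'.
Proof. by move=> bT v; apply: (kspan_morph (h := id)). Qed.

End KSpan.

(** * Action on polynomials and linear independence of the monomials *)

Section WeylAction.
Variables (K : fieldType) (n : nat).
Local Notation P := {mpoly K[n]}.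
Implicit Types (D : weyl K n) (t u : Theta n) (p : P).

Definition weyl_act D : P -> P := polyEnd_fun (weyl_val D).

Lemma weyl_act_inj D D' : weyl_act D =1 weyl_act D' -> D = D'.
Proof. by move=> DD'; apply/val_inj/polyEnd_eq. Qed.

Lemma weyl_act0 p : weyl_act 0 p = 0. Proof. by []. Qed.
Lemma weyl_actD D D' p : weyl_act (D + D') p = weyl_act D p + weyl_act D' p.
Proof. by []. Qed.
Lemma weyl_actZ a D p : weyl_act (a *: D) p = a *: weyl_act D p.
Proof. by []. Qed.
Lemma weyl_actM D D' p : weyl_act (D * D') p = weyl_act D (weyl_act D' p).
Proof. by []. Qed.
Lemma weyl_act_sum I (s : seq I) (Q : pred I) (F : I -> weyl K n) p :
  weyl_act (\sum_(i <- s | Q i) F i) p = \sum_(i <- s | Q i) weyl_act (F i) p.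
Proof. by apply: (big_morph (fun D => weyl_act D p)). Qed.

Lemma weyl_act_wX i p : weyl_act (wX K i) p = 'X_i * p. Proof. by []. Qed.
Lemma weyl_act_wD i p : weyl_act (wD K i) p = p^`M(i). Proof. by []. Qed.

Lemma weyl_act_prodX (a : 'X_{1..n}) p :
  weyl_act (\prod_(i < n) wX K i ^+ a i) p = 'X_[a] * p.
Proof.
rewrite mpolyXE_id; elim/big_rec2: _ => [|i q D _ IH]; first by rewrite mul1r.
rewrite weyl_actM IH -mulrA; move: (q * p) => {IH p D} p.
elim: (a i) => [|k IH]; first by rewrite expr0 mul1r.
by rewrite !exprS weyl_actM IH weyl_act_wX mulrA.
Qed.

Lemma weyl_act_prodD (a : 'X_{1..n}) p :
  weyl_act (\prod_(i < n) wD K i ^+ a i) p = p^`M[a].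
Proof.
rewrite /mderivm /index_enum -enumT.
elim: (enum _) => [|i s IH]; first by rewrite big_nil.
rewrite big_cons weyl_actM IH /=; move: (foldr _ _ _) => {IH} q.
by elim: (a i) => [|k IH] //=; rewrite exprS weyl_actM IH.
Qed.

Lemma weyl_act_wmon t p : weyl_act (wmon K t) p = 'X_[t.1] * p^`M[t.2].
Proof. by rewrite /wmon weyl_actM weyl_act_prodX weyl_act_prodD. Qed.

(** Strong induction on [mdeg t.2]. Apply the relation to ['X_[t.2]] and read the coefficient of
    ['X_[t.1]]. A term [u] other than [t] contributes nothing: its derivative kills ['X_[t.2]]
    unless [u.2] divides [t.2]; if [u.2 = t.2] it yields a multiple of ['X_[u.1]] with [u.1]
    different from [t.1]; otherwise [u.2] has smaller degree and [c u = 0] by induction. *)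
Lemma wmon_sum_eq0 (s : seq (Theta n)) (c : Theta n -> K) :
    [pchar K] =i pred0 -> uniq s ->
  \sum_(t <- s) c t *: wmon K t = 0 -> {in s, forall t, c t = 0}.
Proof.
move=> charK0 s_uniq s0 t.
have [d] := ubnP (mdeg t.2); elim: d t => // d IH t ltd ts.
have := weyl_act_sum s predT (fun t => c t *: wmon K t) 'X_[t.2].
rewrite s0 weyl_act0 (bigD1_seq t) //= => /(congr1 (mcoeff t.1)).
rewrite mcoeff0 mcoeffD raddf_sum /= big_seq_cond big1 => [|u /andP[us ut]].
  rewrite addr0 weyl_actZ weyl_act_wmon mderivmX submm mpolyX0 mcoeffZ.
  rewrite -scalerAr mulr1 mcoeffZ mcoeffX eqxx mulr1.
  move/esym/eqP; rewrite mulf_eq0 => /orP[/eqP //|].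
  rewrite natr_prod prodf_seq_eq0 => /hasP[i _ /andP[_]].
  by rewrite (pcharf0P K).1 // ffactnn eqn0Ngt fact_gt0.
rewrite weyl_actZ mcoeffZ weyl_act_wmon mderivmX.
have [tu|/forallPn[i]] := boolP (u.2 <= t.2)%MM; last first.
  rewrite -ltnNge => tu; rewrite (bigD1 i) //= ffact_small // mul0n.
  by rewrite scale0r mulr0 mcoeff0 mulr0.
have [tu2|tu2] := eqVneq u.2 t.2.
  rewrite tu2 submm mpolyX0 -scalerAr mulr1 mcoeffZ mcoeffX.
  case: eqP => [tu1|_]; last by rewrite !mulr0.
  case/eqP: ut; move: tu1 tu2; case: u t {us tu ltd ts} => [? ?] [? ?] /=.
  by move=> -> ->.
rewrite IH ?mul0r //; apply: leq_trans (ltnSE ltd).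
have := mdegD (t.2 - u.2) u.2; rewrite submK // => ->.
rewrite -[ltnLHS]add0n ltn_add2r lt0n mdeg_eq0.
by apply: contraNneq tu2 => tu0; rewrite -(submK tu) tu0 add0m.
Qed.

Definition tadd t u : Theta n := ((t.1 + u.1)%MM, (t.2 + u.2)%MM).

Lemma tdegD t u : tdeg (tadd t u) = (tdeg t + tdeg u)%N.
Proof. by rewrite /tdeg /= !mdegD addnACA. Qed.

Definition tX i : Theta n := (U_(i)%MM, 0%MM).
Definition tD i : Theta n := (0%MM, U_(i)%MM).

Lemma tdeg_tD i : tdeg (tD i) = 1%N.
Proof. by rewrite /tdeg /= mdeg0 mdeg1. Qed.

Lemma wX_wmon i t : wX K i * wmon K t = wmon K (tadd (tX i) t).
Proof.
apply: weyl_act_inj => p.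
by rewrite weyl_actM !weyl_act_wmon weyl_act_wX /= mulrA add0m mpolyXD.
Qed.

(** This is the Leibniz rule. When [t.1 i = 0], the truncated difference is harmless because its
    coefficient vanishes. *)
Lemma wD_wmon i t : wD K i * wmon K t =
  wmon K (tadd (tD i) t) + (t.1 i)%:R *: wmon K ((t.1 - U_(i))%MM, t.2).
Proof.
apply: weyl_act_inj => p.
rewrite weyl_actM weyl_actD weyl_actZ !weyl_act_wmon weyl_act_wD /=.
rewrite mderivM mderivX add0m addrC scalerAl; congr (_ * _ + _).
by rewrite addmC mderivmDm mderivmU1m.
Qed.

End WeylAction.

(** * Leading symbols for the Bernstein filtration *)

Section Leading.
Variables (K : fieldType) (n : nat).
Implicit Types (D : weyl K n) (t u v : Theta n).

(* The regular module, so that the kspan lemmas apply to A_n itself. *)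
Definition wmon_reg t : (weyl K n)^o := wmon K t.

Lemma bernsteinE r D :
  bernstein r D <-> kspan [set t | (tdeg t <= r)%N] wmon_reg D.
Proof.
split=> -[s [c [sr ->]]]; exists s, c; split=> //; apply: eq_bigr => t _;
by rewrite /GRing.scale /= mulr_algl.
Qed.

Definition lower (d : nat) : set (weyl K n)^o :=
  kspan [set t | (tdeg t < d)%N] wmon_reg.

Lemma lower_le d d' : (d <= d')%N -> lower d `<=` lower d'.
Proof.
by move=> dd'; apply: kspan_sub => t /leq_trans/(_ dd') td; apply: kspan_gen.
Qed.

(** On the associated graded algebra, left multiplication by [D] is multiplication by the
    commutative monomial [u]. Testing on every [t] makes the notion stable under products without
    computing commutators. *)
Definition has_symbol D u := forall t,
  lower (tdeg u + tdeg t) (D * wmon K t - wmon K (tadd u t)).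

Lemma has_symbol_lower D u d L :
  has_symbol D u -> lower d L -> lower (tdeg u + d) (D * L).
Proof.
move=> Du; apply: (@kspan_morph _ _ (weyl K n)^o (weyl K n)^o _ _ _ _ _ _
  (fun L => D * L)) => [a v w|t /= td].
  by rewrite mulrDr /GRing.scale /= mulr_algl -scalerAr mulr_algl.
rewrite -[D * _](subrK (wmon_reg (tadd u t))); apply: kspanD.
  by apply: lower_le (Du t); rewrite leq_add2l ltnW.
by apply: kspan_gen; rewrite /= tdegD ltn_add2l.
Qed.

(** The error of the product at [t] is [D] applied to the error of [D'] at [t], plus the error of
    [D] at [tadd u' t]. *)
Lemma has_symbolM D D' u u' :
  has_symbol D u -> has_symbol D' u' -> has_symbol (D * D') (tadd u u').
Proof.
move=> Du Du' t; have /(has_symbol_lower Du) := Du' t.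
rewrite addnA -tdegD mulrBr mulrA => L1.
have := Du (tadd u' t); rewrite tdegD addnA -tdegD => L2.
have := kspanD L1 L2; rewrite addrA subrK.
by rewrite /tadd /= !addmA.
Qed.

Lemma has_symbolX D u k :
  has_symbol D u -> has_symbol (D ^+ k) ((u.1 *+ k)%MM, (u.2 *+ k)%MM).
Proof.
move=> Du; elim: k => [t|k IH].
  rewrite mul1r /tadd !mulm0n !add0m subrr; exact: kspan0.
by rewrite exprS !mulmS; exact: has_symbolM Du IH.
Qed.

Lemma has_symbol_wX i : has_symbol (wX K i) (tX i).
Proof. by move=> t; rewrite wX_wmon subrr; apply: kspan0. Qed.

Lemma has_symbol_wD i : has_symbol (wD K i) (tD i).
Proof.
move=> t; rewrite wD_wmon addrAC subrr add0r.
have [->|ti] := eqVneq (t.1 i) 0%N; first by rewrite scale0r; apply: kspan0.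
rewrite -mulr_algl; apply/kspanZ/kspan_gen; rewrite /= tdeg_tD add1n ltnS.
by rewrite /tdeg leq_add2r mdegB.
Qed.

Lemma has_symbol_prod (F : 'I_n -> weyl K n) (U : 'I_n -> Theta n)
    (a : 'X_{1..n}) : (forall i, has_symbol (F i) (U i)) ->
  has_symbol (\prod_(i < n) F i ^+ a i)
    ((\sum_(i < n) (U i).1 *+ a i)%MM, (\sum_(i < n) (U i).2 *+ a i)%MM).
Proof.
move=> FU; elim: (index_enum _) => [|i s IH].
  rewrite !big_nil => t; rewrite mul1r /tadd !add0m subrr; exact: kspan0.
by rewrite !big_cons; exact: has_symbolM (has_symbolX (a i) (FU i)) IH.
Qed.

Lemma has_symbol_wmon u : has_symbol (wmon K u) u.
Proof.
have := has_symbolM (has_symbol_prod u.1 has_symbol_wX)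
                    (has_symbol_prod u.2 has_symbol_wD).
rewrite /tadd /= -!multinomUE_id.
have z (a : 'X_{1..n}) : (\sum_(i < n) 0 *+ a i)%MM = 0%MM.
  apply/mnmP => i; rewrite mnm_sumE big1 ?mnmE // => j _.
  by rewrite mulmnE mnmE.
by rewrite !z addm0 add0m -surjective_pairing.
Qed.

End Leading.

(** * The monomial orders: shifts, degrees and well-foundedness *)

Section MonomialOrder.
Variable n : nat.
Implicit Types t u v : Theta n.

(* The order on Theta n is the degree-lexicographic order on monomials in
   n + n variables. *)
Definition mnm_of_theta t : 'X_{1..n + n} := Multinom (cat_tuple t.1 t.2).

Lemma mdeg_mnm_of_theta t : mdeg (mnm_of_theta t) = tdeg t.
Proof. by rewrite /mdeg /= big_cat. Qed.

Lemma tltE t u : tlt t u = (mnm_of_theta t < mnm_of_theta u)%O.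
Proof. by rewrite ltEmnm !mdeg_mnm_of_theta. Qed.

Lemma mnm_of_thetaD t u :
  mnm_of_theta (tadd t u) = (mnm_of_theta t + mnm_of_theta u)%MM.
Proof.
have nthE v k : nth 0%N (mnm_of_theta v) k =
    if (k < n)%N then nth 0%N v.1 k else nth 0%N v.2 (k - n).
  by rewrite nth_cat size_tuple.
apply/mnmP => i; rewrite mnmDE !(mnm_nth 0%N) !nthE.
case: ltnP => ni.
  by have := mnmDE (Ordinal ni) t.1 u.1; rewrite !(mnm_nth 0%N).
have ni' : (i - n < n)%N by rewrite ltn_subLR.
by have := mnmDE (Ordinal ni') t.2 u.2; rewrite !(mnm_nth 0%N).
Qed.

Lemma tlt_add2l v t u : tlt (tadd v t) (tadd v u) = tlt t u.
Proof. by rewrite !tltE !mnm_of_thetaD ltmc_add2r. Qed.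

Lemma tlt_tdeg t u : (tdeg t < tdeg u)%N -> tlt t u.
Proof. by move=> tu; rewrite tltE lt_mdeg_ltmc // !mdeg_mnm_of_theta. Qed.

Lemma tdeg_tlt t u : tlt t u -> (tdeg t <= tdeg u)%N.
Proof.
rewrite tltE -!mdeg_mnm_of_theta => tu.
exact/lemc_mdeg/Order.POrderTheory.ltW.
Qed.

(** The order is a lexicographic product: [ltmwf] gives the outer induction on the monomial, and an
    inner induction on the index in ['I_m] settles ties. *)
Lemma telt_ind m (Q : Thetae n m -> Prop) :
  (forall w, (forall w', telt w' w -> Q w') -> Q w) -> forall w, Q w.
Proof.
move=> IH [t i]; have [x] : exists x, mnm_of_theta t = x by eexists.
move: x t i; apply: ltmwf => x IHx t i tx.
have [k] := ubnP i; elim: k i => // k IHk i ik.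
apply: IH => -[t' i']; rewrite /telt /= tltE tx => /orP[/IHx|]; first exact.
by case/andP => /eqP-> ii'; apply: IHk; apply: leq_trans ii' _.
Qed.

Lemma tlt_trans : transitive (@tlt n).
Proof. by move=> t u v; rewrite !tltE; apply: Order.POrderTheory.lt_trans. Qed.

Lemma telt_trans m : transitive (@telt n m).
Proof.
move=> w u v; rewrite /telt.
case/orP=> [uw|/andP[/eqP-> uw]]; case/orP=> [wv|/andP[/eqP<- wv]].
- by rewrite (tlt_trans uw wv).
- by rewrite uw.
- by rewrite wv.
- by rewrite eqxx (ltn_trans uw wv) orbT.
Qed.

Lemma telt_tedeg m (u w : Thetae n m) : telt u w -> (tedeg u <= tedeg w)%N.
Proof.
by rewrite /telt /tedeg => /orP[/tdeg_tlt|/andP[/eqP-> _]].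
Qed.

End MonomialOrder.

(** * Monomials of a module with chosen generators, and leading monomials *)

Section FreeModule.
Variables (K : fieldType) (n m : nat).
Variables (E : lmodType (weyl K n)) (e : 'I_m -> E).
Implicit Types (w u : Thetae n m) (s : seq (Thetae n m)).

Definition coords s i : seq (Theta n) := [seq u.1 | u <- s & u.2 == i].

Lemma mem_coords s i t : (t \in coords s i) = ((t, i) \in s).
Proof.
apply/mapP/idP => [[[t' j]]|ts].
  by rewrite mem_filter /= => /andP[/eqP-> ts] ->.
by exists (t, i) => //; rewrite mem_filter /= eqxx.
Qed.

Lemma coords_uniq s i : uniq s -> uniq (coords s i).
Proof.
move=> s_uniq; rewrite map_inj_in_uniq ?filter_uniq // => -[t j] [t' j'].
by rewrite !mem_filter /= => /andP[/eqP-> _] /andP[/eqP-> _] ->.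
Qed.

Lemma sum_temon s (c : Thetae n m -> K) :
  \sum_(u <- s) (c u)%:A *: temon e u =
  \sum_i (\sum_(t <- coords s i) c (t, i) *: wmon K t) *: e i.
Proof.
under [RHS]eq_bigr => i _ do rewrite big_map big_filter scaler_suml.
rewrite (exchange_big_dep xpredT) //=; apply: eq_bigr => -[t j] _ /=.
rewrite (big_pred1 j) => [|i]; last by rewrite /= eq_sym.
by rewrite /temon scalerA mulr_algl.
Qed.

(** Uniqueness of the coordinates of 0 makes each coefficient of [e i] vanish in the Weyl algebra,
    where the monomials are independent. *)
Lemma temon_free : [pchar K] =i pred0 -> module_basis e ->
  kfree setT (temon e).
Proof.
move=> charK0 eB s c s_uniq _; rewrite sum_temon => s0 [t i] ts.
have [a [_ aU]] := eB 0.
pose a0 : {ffun 'I_m -> weyl K n} := [ffun=> 0].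
pose a1 : {ffun 'I_m -> weyl K n} :=
  [ffun i => \sum_(t <- coords s i) c (t, i) *: wmon K t].
have /aU a_a1 : 0 = \sum_i a1 i *: e i.
  by rewrite -[LHS]s0; apply: eq_bigr => j _; rewrite ffunE.
have /aU a_a0 : 0 = \sum_i a0 i *: e i.
  by rewrite big1 // => j _; rewrite ffunE scale0r.
have := congr1 (fun b : {ffun 'I_m -> weyl K n} => b i)
  (etrans (esym a_a1) a_a0).
rewrite !ffunE => /(wmon_sum_eq0 charK0 (coords_uniq i s_uniq)); apply.
by rewrite mem_coords.
Qed.

(** [is_LM] refers to some expansion of the vector. By freeness it agrees with the given one, so a
    monomial missing from [s] would have coefficient zero in both. *)
Lemma is_LM_mem s (c : Thetae n m -> K) w : kfree setT (temon e) -> uniq s ->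
  is_LM e (\sum_(u <- s) (c u)%:A *: temon e u) w -> w \in s.
Proof.
move=> eF s_uniq [s' [c' [s'_uniq c'0 ss' ws' _]]].
pose r := undup (s ++ s'); have r_uniq : uniq r by apply: undup_uniq.
move: ss'; rewrite (sum_count_mem _ r_uniq) => [|u us]; last first.
  by rewrite mem_undup mem_cat us.
rewrite [RHS](sum_count_mem _ r_uniq) => [|u us]; last first.
  by rewrite mem_undup mem_cat us orbT.
move/eqP; rewrite -subr_eq0 -sumrB => /eqP rsum0.
pose d u := c u *+ count_mem u s - c' u *+ count_mem u s'.
have : d w = 0.
  apply: (eF r d r_uniq) => //; last by rewrite mem_undup mem_cat ws' orbT.
  rewrite -[RHS]rsum0; apply: eq_bigr => u _.
  by rewrite /d !scalerBl !scalerMnl.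
rewrite /d (count_uniq_mem w s'_uniq) ws' mulr1n.
move/eqP; apply: contraLR => ws.
by rewrite (count_memPn ws) sub0r oppr_eq0 c'0.
Qed.

(** Stated for any family [e], since it is applied to the generators [f] of [M]. *)
Lemma filtrationE r :
  filtration e r = kspan [set w | (tedeg w <= r)%N] (temon e).
Proof.
apply/seteqP; split=> [_ [D [Dr ->]]|_ [s [c [sr ->]]]].
  apply: kspan_sum => i _.
  have /bernsteinE := Dr i.
  apply: (@kspan_morph _ _ (weyl K n)^o E _ _ _ _ _ _ (fun D => D *: e i)).
    by move=> a v w; rewrite scalerDl -scalerA.
  by move=> t tr; exact: (@kspan_gen _ _ _ _ _ (temon e) (t, i)).
rewrite sum_temon.
exists (fun i => \sum_(t <- coords s i) c (t, i) *: wmon K t); split=> // i.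
exists (coords s i), (fun t => c (t, i)); split=> // t.
by rewrite mem_coords => /sr.
Qed.

Lemma wmonZ_temon (t : Theta n) u :
  kspan [set v | telt v (tadd t u.1, u.2)] (temon e)
    (wmon K t *: temon e u - temon e (tadd t u.1, u.2)).
Proof.
rewrite /temon scalerA -scalerBl.
have := has_symbol_wmon K t u.1.
apply: (@kspan_morph _ _ (weyl K n)^o E _ _ _ _ _ _ (fun D => D *: e u.2)).
  by move=> a v w; rewrite scalerDl -scalerA.
move=> v /= vt; apply: (@kspan_gen _ _ _ _ _ (temon e) (v, u.2)).
by rewrite /telt /= tlt_tdeg ?tdegD.
Qed.

(** The scalar [a] is the leading coefficient of [f]: the error at [u] has lower degree, and every
    other monomial of [f] stays below [u] after the shift by [t]. *)
Lemma is_LM_mul (t : Theta n) f u : is_LM e f u ->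
  exists2 a : K, a != 0 & kspan [set v | telt v (tadd t u.1, u.2)] (temon e)
    (wmon K t *: f - a%:A *: temon e (tadd t u.1, u.2)).
Proof.
case=> s [c [s_uniq c0 -> us sltu]]; exists (c u); first exact: c0.
rewrite scaler_sumr (bigD1_seq u) //= addrAC.
have comm v : wmon K t *: ((c v)%:A *: temon e v) =
    (c v)%:A *: (wmon K t *: temon e v).
  by rewrite !scalerA mulr_algl mulr_algr.
apply: kspanD; first by rewrite comm -scalerBr; apply/kspanZ/wmonZ_temon.
rewrite big_seq_cond; apply: kspan_sum => v /andP[vs vu]; rewrite comm.
(* The product is split into the shifted monomial and its lower-degree error, both below the shift
   of [u]. *)
apply: kspanZ; rewrite -[_ *: _](subrK (temon e (tadd t v.1, v.2))).
have vu_lt : telt (tadd t v.1, v.2) (tadd t u.1, u.2).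
  have := sltu v vs vu; rewrite /telt /= tlt_add2l.
  case/orP=> [->//|/andP[/eqP-> ->]].
  by rewrite eqxx orbT.
apply: kspanD; last exact: kspan_gen.
apply: kspan_sub (wmonZ_temon t v) => x /= xv; apply: kspan_gen.
exact: telt_trans xv vu_lt.
Qed.

End FreeModule.

(* Characteristic 0 is what "each element of A_n is uniquely a K-linear
   combination of monomials" amounts to for the subalgebra A_n of
   End_K(K[x_1, ..., x_n]): in characteristic p > 0 one has d_i ^ p = 0. *)
Theorem theorem9 (K : fieldType) (charK0 : [pchar K] =i pred0)
    (n : nat) (n_gt0 : (0 < n)%N) (m : nat)
    (M : lmodType (weyl K n)) (f : 'I_m -> M) (f_gen : generators f)
    (E : lmodType (weyl K n)) (e : 'I_m -> E) (e_basis : module_basis e)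
    (pi : {linear E -> M}) (pi_e : forall i, pi (e i) = f i)
    (s : nat) (g : 'I_s -> E)
    (g_groebner : groebner_basis e [set v : E | pi v = 0] g)
    (r : nat) :
  kbasis (irreducible_monomials e g r) (fun w => pi (temon e w))
    (filtration f r).
Proof.
have eF := temon_free charK0 e_basis.
have [_ g_ker g_LM] := g_groebner.
have piZ (D : weyl K n) v : pi (D *: v) = D *: pi v by exact: linearZ_LR.
have piE w : pi (temon e w) = temon f w by rewrite piZ pi_e.
split=> [s' c s'_uniq s'_irr s'0|].
  pose v := \sum_(w <- s') (c w)%:A *: temon e w.
  have v_ker : pi v = 0.
    rewrite raddf_sum -[RHS]s'0; apply: eq_bigr => w _.
    by rewrite /= linearZ.
  have [v0|v0] := eqVneq v 0; first exact: eF v0.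
  have [j [u [w [gu vw uw]]]] := g_LM v v_ker v0.
  (* The leading monomial [w] of [v] lies in [s'], hence is irreducible, yet [u] divides it. *)
  have [_ /(_ j u gu)/negP[]//] := s'_irr w (is_LM_mem eF s'_uniq vw).
rewrite filtrationE; apply/seteqP; split; apply: kspan_sub => w.
  by case=> wr _; rewrite piE; apply: kspan_gen.
rewrite -piE /=; elim/telt_ind: w => w IH wr.
have [w_irr|] := pselect (irreducible_monomials e g r w).
  exact: (@kspan_gen _ _ _ _ _ (fun w => pi (temon e w))).
move=> w_red.
have [j [u [gu uw]]] : exists j u, is_LM e (g j) u /\ tedvd u w.
  apply: contrapT => no_u; apply: w_red; split=> // j u gu.
  by apply/negP => uw; apply: no_u; exists j, u.
case/andP: uw => /eqP uw2 /andP[uw1 uw1'].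
(* The quotient of [w] by [u]; the truncated subtractions are exact by divisibility. *)
pose t : Theta n := ((w.1.1 - u.1.1)%MM, (w.1.2 - u.1.2)%MM).
have tw : (tadd t u.1, u.2) = w.
  by rewrite uw2 /tadd /= !submK // -!surjective_pairing.
have [a a0] := is_LM_mul t gu; rewrite tw => lowE.
have low : kspan (irreducible_monomials e g r) (fun w => pi (temon e w))
    (pi (wmon K t *: g j - a%:A *: temon e w)).
  apply: kspan_morph lowE => [b x y|x /= xw]; first by rewrite linearP.
  (* Monomials below [w] still have degree at most [r], so reduction stays inside the same
     filtration step. *)
  apply: IH => //; apply: leq_trans wr; exact: telt_tedeg.
have pi_head : pi (wmon K t *: g j - a%:A *: temon e w) =
    - (a%:A *: pi (temon e w)).
  rewrite linearB (piZ (wmon K t)) (piZ a%:A) (g_ker j : pi (g j) = 0).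
  by rewrite scaler0 sub0r.
(* Since [a] is nonzero, [pi (temon e w)] is recovered by negating and scaling by [a^-1]. *)
move: low; rewrite pi_head => /kspanN/(kspanZ a^-1).
by rewrite opprK scalerA mulr_algl scalerA mulVf ?scale1r.
Qed.
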